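(* Let $G=(V,(E_i)_{i\in[k]})$ be a multilayer network with positive edge weights $w_i\colon E_i\to\mathbb{R}_{>0}$ $(i\in[k])$, and let $\bm{\alpha}\in\mathbb{R}_{\ge 0}^k$ and $\bm{\beta}\in\mathbb{R}^k$. If the LP-based algorithm (described in the context) takes a basic optimal solution $((\hat{x}_e)_{e\in E},(\hat{y}_v)_{v\in V},\hat{t})$ to the LP, then its output $\hat{p}$ has support size at most $k$, i.e., $|\mathrm{supp}(\hat{p})|\le k$.
   Context: Notation: $[k]=\{1,\dots,k\}$ with $k\ge 1$. A multilayer network $G=(V,(E_i)_{i\in[k]})$ consists of a finite nonempty vertex set $V$ and, for each layer $i\in[k]$, a set $E_i$ of undirected edges $\{u,v\}$ ($u\neq v$, $u,v\in V$). Put $E=\bigcup_{i\in[k]}E_i$. $\Delta(2^V)$ is the set of probability distributions on $2^V$; for $p\in\Delta(2^V)$, $p_S$ is the probability of $S\subseteq V$, and $\mathrm{supp}(p)=\{S\subseteq V\mid p_S>0\}$. The LP, in real variables $((x_e)_{e\in E},(y_v)_{v\in V},t)$: maximize $t$ subject to $t\le\alpha_i\sum_{e\in E_i}w_i(e)x_e+\beta_i$ for all $i\in[k]$; $x_e\le y_u$ and $x_e\le y_v$ for all $e=\{u,v\}\in E$; $\sum_{v\in V}y_v=1$; $x_e\ge 0$ and $y_v\ge 0$ for all $e\in E$, $v\in V$. A basic solution of the LP is a feasible solution for which the constraints satisfied with equality (including the nonnegativity constraints) have a coefficient matrix of full rank, i.e., rank equal to the number $|E|+|V|+1$ of variables.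 A basic optimal solution is a basic solution that is optimal. LP-based algorithm: (1) compute an optimal solution $((\hat{x}_e)_{e\in E},(\hat{y}_v)_{v\in V},\hat{t})$ to the LP. (2) Let $0=r_0<r_1<\cdots<r_\ell$ be the reals with $\{r_0,r_1,\dots,r_\ell\}=\{\hat{y}_v\mid v\in V\}\cup\{0\}$. (3) Let $S_j=\{v\in V\mid\hat{y}_v\ge r_j\}$ for $j=1,\dots,\ell$. (4) Return $\hat{p}\in\Delta(2^V)$ with $\hat{p}_{S_j}=(r_j-r_{j-1})\cdot|S_j|$ for $j=1,\dots,\ell$ and $\hat{p}_S=0$ for all other $S\subseteq V$. *)

(* Defs.v *)
From mathcomp Require Import all_boot all_order all_algebra.
From mathcomp Require Import reals.
Set Implicit Arguments.
Unset Strict Implicit.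
Unset Printing Implicit Defensive.
Import Order.TTheory GRing.Theory Num.Theory.
Local Open Scope ring_scope.

Section LinearProgram.
Variable R : realType.

(* Maximize [\sum_j lp_obj j * z j] over [z : J -> R], where row [i : I] reads
   [\sum_j lp_coef i j * z j = lp_rhs i] if [lp_is_eq i], and
   [\sum_j lp_coef i j * z j <= lp_rhs i] otherwise. *)
Record linear_program (I J : finType) := LinearProgram {
  lp_obj : J -> R;
  lp_coef : I -> J -> R;
  lp_rhs : I -> R;
  lp_is_eq : pred I
}.

Variables (I J : finType) (P : linear_program I J).
Implicit Type z : J -> R.

Definition lp_value z : R := \sum_j lp_obj P j * z j.

Definition lp_lhs z (i : I) : R := \sum_j lp_coef P i j * z j.

Definition lp_feasible z : Prop :=
  forall i, if lp_is_eq P i then lp_lhs z i = lp_rhs P i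
            else lp_lhs z i <= lp_rhs P i.

Definition lp_optimal z : Prop :=
  lp_feasible z /\ forall z', lp_feasible z' -> lp_value z' <= lp_value z.

Definition lp_tight z : {set I} := [set i | lp_lhs z i == lp_rhs P i].

Definition lp_tight_mx z : 'M[R]_(#|lp_tight z|, #|J|) :=
  \matrix_(a, b) lp_coef P (enum_val a) (enum_val b).

Definition lp_basic z : Prop :=
  lp_feasible z /\ \rank (lp_tight_mx z) = #|J|.

Definition lp_basic_optimal z : Prop := lp_basic z /\ lp_optimal z.

End LinearProgram.

Record multilayer_network (V : finType) (k : nat) := MultilayerNetwork {
  layer :> 'I_k -> {set {set V}};
  layer_card2 : forall i (e : {set V}), e \in layer i -> #|e| = 2%N
}.

Section NetworkLP.
Variables (R : realType) (V : finType) (k : nat) (G : multilayer_network V k).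

Definition edges : {set {set V}} := \bigcup_(i < k) layer G i.

Definition edge : finType := {e : {set V} | e \in edges}.

Definition incidence : finType := {ev : edge * V | ev.2 \in val ev.1}.

(* The variables [x_e], [y_v] and [t]. *)
Definition lp_var : finType := (edge + V + unit)%type.

Definition lp_sol (x : edge -> R) (y : V -> R) (t : R) (j : lp_var) : R :=
  match j with
  | inl (inl e) => x e
  | inl (inr v) => y v
  | inr tt => t
  end.

(* In order: one row per layer; [x_e <= y_v] for [v \in e]; [\sum_v y_v = 1];
   [0 <= x_e]; [0 <= y_v]. *)
Definition lp_row : finType := ('I_k + incidence + unit + edge + V)%type.

Variables (w : 'I_k -> {set V} -> R) (alpha beta : 'I_k -> R).

(* [lp_sol a b c] is the row with coefficient [a e] on [x_e], [b v] on [y_v]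
   and [c] on [t]; [lp_feasibleE] below spells the system out. *)
Definition network_coef (i : lp_row) : lp_var -> R :=
  match i with
  | inl (inl (inl (inl i))) =>
      lp_sol (fun e => if val e \in layer G i then - (alpha i * w i (val e))
                       else 0)
             (fun=> 0) 1
  | inl (inl (inl (inr ev))) =>
      lp_sol (fun e => (e == (val ev).1)%:R) (fun v => - (v == (val ev).2)%:R) 0
  | inl (inl (inr tt)) => lp_sol (fun=> 0) (fun=> 1) 0
  | inl (inr e) => lp_sol (fun e' => - (e' == e)%:R) (fun=> 0) 0
  | inr v => lp_sol (fun=> 0) (fun v' => - (v' == v)%:R) 0
  end.

Definition network_rhs (i : lp_row) : R :=
  match i with
  | inl (inl (inl (inl i))) => beta i
  | inl (inl (inr tt)) => 1
  | _ => 0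
  end.

Definition network_is_eq (i : lp_row) : bool :=
  if i is inl (inl (inr tt)) then true else false.

Definition network_lp : linear_program R lp_row lp_var :=
  LinearProgram (lp_sol (fun=> 0) (fun=> 0) 1)
    network_coef network_rhs network_is_eq.

Lemma card_lp_var : #|lp_var| = (#|edges| + #|V| + 1)%N.
Proof. by rewrite !card_sum card_unit card_sig; congr (_ + _ + _)%N. Qed.

Lemma sum_lp_sol a b c x y t :
  \sum_j lp_sol a b c j * lp_sol x y t j =
  \sum_e a e * x e + \sum_v b v * y v + c * t.
Proof.
rewrite big_sumType big_sumType /=; congr (_ + _).
by rewrite (bigD1 tt) //= big1 ?addr0 // => -[].
Qed.

Lemma lp_valueE x y t : lp_value network_lp (lp_sol x y t) = t.
Proof.
rewrite /lp_value sum_lp_sol big1 => [|e _]; last by rewrite mul0r.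
by rewrite big1 => [|v _]; rewrite ?mul0r // mul1r !add0r.
Qed.

Lemma sum_indic (T : finType) (f : T -> R) i : \sum_j (j == i)%:R * f j = f i.
Proof.
rewrite (bigD1 i) //= eqxx mul1r big1 ?addr0 // => j /negPf->.
by rewrite mul0r.
Qed.

Lemma sum_indicN (T : finType) (f : T -> R) i :
  \sum_j - (j == i)%:R * f j = - f i.
Proof.
rewrite -[in RHS](sum_indic f i) -sumrN.
by apply: eq_bigr => j _; rewrite mulNr.
Qed.

Lemma sum_zero (T : finType) (f : T -> R) : \sum_j 0 * f j = 0.
Proof. by rewrite big1 // => j _; rewrite mul0r. Qed.

Lemma lp_feasibleE x y t :
  lp_feasible network_lp (lp_sol x y t) <->
  [/\ forall i : 'I_k,
        t <= alpha i * \sum_(e : edge | val e \in layer G i) w i (val e) * x e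
             + beta i,
      forall (e : edge) v, v \in val e -> x e <= y v,
      \sum_v y v = 1,
      forall e, 0 <= x e
    & forall v, 0 <= y v].
Proof.
have rowL i : lp_lhs network_lp (lp_sol x y t) (inl (inl (inl (inl i)))) =
   t - alpha i * \sum_(e : edge | val e \in layer G i) w i (val e) * x e.
  rewrite /lp_lhs sum_lp_sol sum_zero addr0 mul1r addrC; congr (_ + _).
  rewrite mulr_sumr -sumrN [RHS]big_mkcond /=.
  by apply: eq_bigr => e _; case: ifP => _; rewrite ?mul0r // mulNr mulrA.
have rowI ev : lp_lhs network_lp (lp_sol x y t) (inl (inl (inl (inr ev)))) =
   x (val ev).1 - y (val ev).2.
  by rewrite /lp_lhs sum_lp_sol sum_indic sum_indicN mul0r addr0.
have row1 : lp_lhs network_lp (lp_sol x y t) (inl (inl (inr tt))) = \sum_v y v.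
  rewrite /lp_lhs sum_lp_sol sum_zero mul0r addr0 add0r.
  by apply: eq_bigr => v _; rewrite mul1r.
have rowX e : lp_lhs network_lp (lp_sol x y t) (inl (inr e)) = - x e.
  by rewrite /lp_lhs sum_lp_sol sum_zero sum_indicN mul0r !addr0.
have rowY v : lp_lhs network_lp (lp_sol x y t) (inr v) = - y v.
  by rewrite /lp_lhs sum_lp_sol sum_zero sum_indicN mul0r addr0 add0r.
split=> [Hf | [HL HI H1 HX HY]].
  split.
  - move=> i; have := Hf (inl (inl (inl (inl i)))).
    by rewrite rowL /= lerBlDl.
  - move=> e v ve; have := Hf (inl (inl (inl (inr (exist _ (e, v) ve))))).
    by rewrite rowI /= subr_le0.
  - by have := Hf (inl (inl (inr tt))); rewrite row1.
  - by move=> e; have := Hf (inl (inr e)); rewrite rowX /= oppr_le0.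
  - by move=> v; have := Hf (inr v); rewrite rowY /= oppr_le0.
move=> [[[[i|ev]|[]]|e]|v].
- by rewrite rowL /= lerBlDl HL.
- by rewrite rowI /= subr_le0 HI // (valP ev).
- by rewrite row1.
- by rewrite rowX /= oppr_le0.
- by rewrite rowY /= oppr_le0.
Qed.

End NetworkLP.

Section Rounding.
Variables (R : realType) (V : finType).
Implicit Types (y : V -> R) (p : {ffun {set V} -> R}).

Definition is_distribution p : Prop :=
  (forall S, 0 <= p S) /\ \sum_S p S = 1.

Definition supp p : {set {set V}} := [set S | 0 < p S].

(* [:: r_0; r_1; ...; r_l], with [r_0 = 0] when [y] is nonnegative. *)
Definition levels y : seq R :=
  sort (fun a b : R => a <= b) (undup (0 :: codom y)).

Definition num_levels y : nat := (size (levels y)).-1.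

Definition level y (j : nat) : R := nth 0 (levels y) j.

Definition level_set y (j : nat) : {set V} := [set v | level y j <= y v].

(* The distribution returned by the algorithm; it depends only on the [y] part
   of the LP solution.  The ordinal [j] stands for the index [j.+1] in 1..l.
   The sets [level_set y j.+1] are pairwise distinct when [y] is nonnegative,
   so the choice made by [pick] is irrelevant; see [lp_output_level] and
   [lp_output_other]. *)
Definition lp_output y : {ffun {set V} -> R} :=
  [ffun S => if [pick j : 'I_(num_levels y) | level_set y j.+1 == S] is Some j
             then (level y j.+1 - level y j) * #|level_set y j.+1|%:R
             else 0].

Lemma size_levels y : size (levels y) = (num_levels y).+1.
Proof.
rewrite /num_levels prednK // size_sort.
by have : 0 \in undup (0 :: codom y); [rewrite mem_undup inE eqxx | case: undup].
Qed.

Lemma mem_levels y a : (a \in levels y) = (a == 0) || (a \in codom y).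
Proof. by rewrite mem_sort mem_undup inE. Qed.

Lemma level_lt y i j :
  (i <= num_levels y)%N -> (j <= num_levels y)%N ->
  (level y i < level y j) = (i < j)%N.
Proof.
move=> Hi Hj.
have us : uniq (levels y) by rewrite sort_uniq undup_uniq.
have ss : sorted <=%R (levels y) by apply: sort_sorted; exact: le_total.
have lts : sorted <%R (levels y) by rewrite lt_sorted_uniq_le us.
by rewrite /level (lt_sorted_ltn_nth 0 lts) // inE size_levels ltnS.
Qed.

Lemma level0 y : (forall v, 0 <= y v) -> level y 0 = 0.
Proof.
move=> y0.
have pos a : a \in levels y -> 0 <= a.
  by rewrite mem_levels => /orP[/eqP-> // | /codomP[v ->]].
have h : 0 \in levels y by rewrite mem_levels eqxx.
have hs : (index (0%R : R) (levels y) <= num_levels y)%N.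
  by rewrite -ltnS -size_levels index_mem.
apply/eqP; rewrite eq_le pos ?mem_nth ?size_levels // andbT.
rewrite -[leRHS](nth_index 0 h) -/(level y _) leNgt level_lt //.
Qed.

Lemma level_set_inj y : (forall v, 0 <= y v) ->
  {in [pred j | (0 < j <= num_levels y)%N] &, injective (level_set y)}.
Proof.
move=> y0.
have key i j : (j <= num_levels y)%N -> (i < j)%N ->
    (0 < i)%N -> level_set y i <> level_set y j.
  move=> lj lij i0; have li := leq_trans (ltnW lij) lj.
  have : level y i \in levels y by rewrite mem_nth // size_levels ltnS.
  rewrite mem_levels => /orP[/eqP e|/codomP[v ev]] /setP E.
    have := level_lt (leq0n (num_levels y)) li.
    by rewrite level0 // e ltxx i0.
  have := E v; rewrite !inE ev lexx -ev.
  by rewrite leNgt level_lt // lij.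
move=> i j /andP[i0 il] /andP[j0 jl] E.
case: (ltngtP i j) => // lij; first by have := key _ _ jl lij i0.
by have := key _ _ il lij j0; case.
Qed.

Lemma lp_output_level y j : (forall v, 0 <= y v) ->
  (0 < j <= num_levels y)%N ->
  lp_output y (level_set y j) =
  (level y j - level y j.-1) * #|level_set y j|%:R.
Proof.
move=> y0 /andP[j0 jl]; rewrite ffunE; case: pickP => [i /eqP E | /= N].
  have -> : j = i.+1 by apply: (level_set_inj y0) => //; rewrite inE ?j0 //=.
  by [].
have lj : (j.-1 < num_levels y)%N by rewrite prednK.
by have := N (Ordinal lj); rewrite /= prednK // eqxx.
Qed.

Lemma lp_output_other y (S : {set V}) :
  (forall j, (0 < j <= num_levels y)%N -> S != level_set y j) ->
  lp_output y S = 0.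
Proof.
move=> N; rewrite ffunE; case: pickP => // j /eqP E.
by have := N j.+1; rewrite E eqxx ltn_ord /= => /(_ isT).
Qed.

Lemma lp_output_dist y : (forall v, 0 <= y v) -> \sum_v y v = 1 ->
  is_distribution (lp_output y).
Proof.
move=> y0 y1; split=> [S|].
  rewrite ffunE; case: pickP => // j _; apply: mulr_ge0; last exact: ler0n.
  by rewrite subr_ge0 ltW // level_lt // ltnW.
pose f (j : 'I_(num_levels y)) := level_set y j.+1.
have finj : injective f.
  move=> i j /(level_set_inj y0) E; apply/val_inj/succn_inj; apply: E;
  by rewrite inE /= ltn_ord.
rewrite (bigID (mem (f @: setT))) /= [X in _ + X]big1 ?addr0; last first.
  move=> S NS; apply: lp_output_other => -[//|j] /= jl.
  apply: contra NS => /eqP->; apply/imsetP; exists (Ordinal jl) => //.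
rewrite big_imset /=; last by move=> i j _ _; exact: finj.
transitivity (\sum_(j < num_levels y) \sum_v
    (if level y j.+1 <= y v then level y j.+1 - level y j else 0)).
  apply: eq_big => [j|j _]; first by rewrite inE.
  rewrite lp_output_level ?ltn_ord // -big_mkcond /= sumr_const mulr_natr.
  by congr (_ *+ _); apply: eq_card => v; rewrite !inE.
rewrite exchange_big /= -y1; apply: eq_bigr => v _.
have hv : y v \in levels y by rewrite mem_levels codom_f orbT.
set m := index (y v) (levels y).
have ml : (m <= num_levels y)%N by rewrite -ltnS -size_levels index_mem.
have yE : level y m = y v by rewrite /level nth_index.
rewrite -(big_mkord xpredT (fun j => if level y j.+1 <= y v
   then level y j.+1 - level y j else 0)) (big_cat_nat _ ml) //=.
rewrite [X in _ + X]big_nat_cond [X in _ + X]big1 => [|j]; last first.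
  rewrite andbT => /andP[mj jl].
  by rewrite -yE leNgt level_lt // ltnS mj.
rewrite addr0 -yE -[RHS]subr0 -[X in _ - X](level0 y0).
rewrite -(telescope_sumr (level y)) //.
rewrite !big_nat; apply: eq_bigr => j /= jm.
have jl := leq_trans jm ml.
by rewrite leNgt level_lt // ltnS -ltnNge jm.
Qed.

End Rounding.

(* Main.v *)
(* Moving all the variables [x_e] and [y_v] that share a common positive value
   by the same amount keeps tight every tight constraint [x_e <= y_v],
   [0 <= x_e] and [0 <= y_v].  Together with the variable [t] this gives
   [l + 1] independent directions, where [l] is the number of positive values
   of [y].  At a basic solution no nonzero direction is annihilated by all the
   tight rows, so the [k + 1] remaining rows (the layers and [\sum_v y_v = 1])
   must separate them: [l + 1 <= k + 1]. *)
Require Import Defs.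
From mathcomp Require Import all_boot all_order all_algebra.
From mathcomp Require Import reals.
Set Implicit Arguments.
Unset Strict Implicit.
Unset Printing Implicit Defensive.
Import Order.TTheory GRing.Theory Num.Theory.
Local Open Scope ring_scope.

Section BasicSolution.
Variables (R : realType) (I J : finType) (P : linear_program R I J).

Lemma lp_lhs_sum m (u : 'I_m -> R) (d : 'I_m -> J -> R) i :
  lp_lhs P (fun c => \sum_j u j * d j c) i = \sum_j u j * lp_lhs P (d j) i.
Proof.
under [RHS]eq_bigr => j _ do rewrite mulr_sumr.
rewrite exchange_big /=; apply: eq_bigr => c _; rewrite mulr_sumr.
by apply: eq_bigr => j _; rewrite mulrCA.
Qed.

(** [row_full] says that the rank equals the number of columns, so multiplication by the tight
    matrix is injective on column vectors such as [D]. *)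
Lemma lp_basic_ker z d : lp_basic P z ->
  (forall i, i \in lp_tight P z -> lp_lhs P d i = 0) -> d =1 (fun=> 0).
Proof.
move=> [_ rkA] d0.
have fullA : row_full (lp_tight_mx P z) by rewrite /row_full rkA.
pose D : 'cV[R]_#|J| := \col_c d (enum_val c).
have AD0 : lp_tight_mx P z *m D = 0.
  apply/matrixP => a j; rewrite !mxE -[RHS](d0 _ (enum_valP a)).
  rewrite /lp_lhs (reindex _ (onW_bij _ (@enum_val_bij J))) /=.
  by apply: eq_bigr => c _; rewrite !mxE.
have D0 : D = 0 by apply: (row_full_inj fullA); rewrite AD0 mulmx0.
by move=> c; move/matrixP: D0 => /(_ (enum_rank c) 0); rewrite !mxE enum_rankK.
Qed.

Lemma lp_basic_independent_le z m (d : 'I_m -> J -> R) (K : {set I}) :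
  lp_basic P z ->
  (forall i j, i \in lp_tight P z -> i \notin K -> lp_lhs P (d j) i = 0) ->
  (forall u : 'I_m -> R,
     (forall c, \sum_j u j * d j c = 0) -> forall j, u j = 0) ->
  (m <= #|K|)%N.
Proof.
move=> bz d0 free; rewrite leqNgt; apply/negP => ltKm.
pose B : 'M[R]_(m, #|K|) := \matrix_(j, a) lp_lhs P (d j) (enum_val a).
(* [B] has more rows than columns, so some nonzero [u] combines the directions into one that every
   row in [K] annihilates. *)
have : kermx B != 0.
  by rewrite -mxrank_eq0 mxrank_ker subn_eq0 -ltnNge
    (leq_ltn_trans (rank_leq_col B)).
case/rowV0Pn => u /sub_kermxP uB0 /eqP; apply; apply/rowP => j; rewrite mxE.
apply: (free (u 0)); apply: (lp_basic_ker bz) => i ti; rewrite lp_lhs_sum.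
have [iK|iK] := boolP (i \in K); last first.
  by apply: big1 => a _; rewrite d0 ?mulr0.
move/rowP: uB0 => /(_ (enum_rank_in iK i)); rewrite !mxE => /(etrans _); apply.
by apply: eq_bigr => a _; rewrite mxE enum_rankK_in.
Qed.

End BasicSolution.

Section Levels.
Variables (R : realType) (V : finType) (y : V -> R).

Lemma level_inj : {in [pred j | (j <= num_levels y)%N] &, injective (level y)}.
Proof.
move=> i j il jl /eqP; rewrite eq_le !leNgt !level_lt //.
by rewrite -!leqNgt -eqn_leq => /eqP.
Qed.

Lemma level_pos j : (forall v, 0 <= y v) -> (0 < j <= num_levels y)%N ->
  0 < level y j.
Proof.
by move=> y0 /andP[j0 jl]; rewrite -(level0 y0) level_lt.
Qed.

(** [levels] also contains 0, which [y] may not attain; positivity of the level excludes that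
    case. *)
Lemma level_codom j : (forall v, 0 <= y v) -> (0 < j <= num_levels y)%N ->
  exists v, y v = level y j.
Proof.
move=> y0 jl; have := level_pos y0 jl; case/andP: jl => _ jl lj.
have : level y j \in levels y by rewrite mem_nth // size_levels ltnS.
by rewrite mem_levels gt_eqF //= => /codomP[v ->]; exists v.
Qed.

Lemma card_supp_le : (#|supp (lp_output y)| <= num_levels y)%N.
Proof.
pose L := [set level_set y (val j).+1 | j : 'I_(num_levels y)].
suff /subset_leq_card/leq_trans : supp (lp_output y) \subset L.
  by apply; rewrite (leq_trans (leq_imset_card _ _)) ?card_ord.
apply/subsetP => S; rewrite inE; apply: contraTT => SL.
rewrite lp_output_other ?ltxx // => -[//|j] /= jl.
by apply: contra SL => /eqP ->; apply/imsetP; exists (Ordinal jl).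
Qed.

End Levels.

Section Network.
Variables (R : realType) (V : finType) (k : nat) (G : multilayer_network V k).
Variables (w : 'I_k -> {set V} -> R) (alpha beta : 'I_k -> R).
Local Notation P := (network_lp G w alpha beta).

Lemma lp_lhs_incidence x y t ev :
  lp_lhs P (lp_sol x y t) (inl (inl (inl (inr ev)))) =
  x (val ev).1 - y (val ev).2.
Proof. by rewrite /lp_lhs sum_lp_sol sum_indic sum_indicN mul0r addr0. Qed.

Lemma lp_lhs_edge x y t e : lp_lhs P (lp_sol x y t) (inl (inr e)) = - x e.
Proof. by rewrite /lp_lhs sum_lp_sol sum_zero sum_indicN mul0r !addr0. Qed.

Lemma lp_lhs_vertex x y t v : lp_lhs P (lp_sol x y t) (inr v) = - y v.
Proof. by rewrite /lp_lhs sum_lp_sol sum_zero sum_indicN mul0r addr0 add0r. Qed.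

Lemma lp_basic_num_levels x y t :
  lp_basic P (lp_sol x y t) -> (num_levels y <= k)%N.
Proof.
move=> bz; have [/lp_feasibleE[_ _ _ _ y0] _] := bz.
(* For [j != 0], [g j] is the indicator of the value [level y j]. Applying it to both [x] and [y]
   gives equal entries wherever [x] and [y] agree. *)
pose g (j : 'I_(num_levels y).+1) a : R := ((j != 0) && (a == level y j))%:R.
(* Level 0 is not a positive value of [y]; its index serves for [t]. *)
pose d j : lp_var G -> R := lp_sol (g j \o x) (g j \o y) (j == 0)%:R.
pose row (o : option 'I_k) : lp_row G :=
  if o is Some i then inl (inl (inl (inl i))) else inl (inl (inr tt)).
have jle (j : 'I_(num_levels y).+1) : (j <= num_levels y)%N by rewrite -ltnS.
(* Variables equal to 0 do not move, so tight nonnegativity rows stay tight. *)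
have g0 j : g j 0 = 0.
  rewrite /g; have [//|jn0] := eqVneq j 0.
  by rewrite lt_eqF // level_pos // lt0n jle andbT; exact: jn0.
have : ((num_levels y).+1 <= #|[set row o | o in [set: option 'I_k]]|)%N.
  apply: (lp_basic_independent_le (d := d) bz).
    move=> [[[[i|ev]|[]]|e]|v] j; rewrite inE => + nK.
    - by case/negP: nK; apply/imsetP; exists (Some i).
    - by rewrite !lp_lhs_incidence /= subr_eq0 => /eqP ->; rewrite subrr.
    - by case/negP: nK; apply/imsetP; exists None.
    - by rewrite !lp_lhs_edge /= oppr_eq0 => /eqP ->; rewrite g0 oppr0.
    - by rewrite !lp_lhs_vertex /= oppr_eq0 => /eqP ->; rewrite g0 oppr0.
  (* The [t] coordinate isolates [u 0]. For [j != 0], a vertex of value [level y j] isolates [u j],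
     since distinct indices give distinct levels. *)
  move=> u ud0 j; have [->|jn0] := eqVneq j 0.
    rewrite -[RHS](ud0 (inr tt)) (bigD1 0) //= mulr1.
    by rewrite big1 ?addr0 // => i /negPf ->; rewrite mulr0.
  have [|v yv] := @level_codom _ _ y j y0.
    by rewrite lt0n jle andbT; exact: jn0.
  rewrite -[RHS](ud0 (inl (inr v))) (bigD1 j) //= /g yv jn0 eqxx mulr1.
  rewrite big1 ?addr0 // => i ij; rewrite (inj_in_eq (@level_inj _ _ y)) ?inE //.
  by rewrite [(j : nat) == _]eq_sym val_eqE (negPf ij) andbF mulr0.
(* [option 'I_k] indexes the exceptional rows, so there are at most [k + 1]; the extra one cancels
   against the direction of [t]. *)
move/leq_trans/(_ (leq_imset_card _ _)).
by rewrite cardsT card_option card_ord ltnS.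
Qed.

End Network.

Theorem theorem5p5 (R : realType) (V : finType) (k : nat)
    (hV : (0 < #|V|)%N) (hk : (0 < k)%N)
    (G : multilayer_network V k)
    (w : 'I_k -> {set V} -> R)
    (hw : forall (i : 'I_k) (e : {set V}), e \in layer G i -> 0 < w i e)
    (alpha beta : 'I_k -> R) (halpha : forall i : 'I_k, 0 <= alpha i)
    (x : edge G -> R) (y : V -> R) (t : R)
    (hopt : lp_basic_optimal (network_lp G w alpha beta) (lp_sol x y t)) :
  (#|supp (lp_output y)| <= k)%N.
Proof.
exact: leq_trans (card_supp_le y) (lp_basic_num_levels (proj1 hopt)).
Qed.
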